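(* Let $G$ be a Lichnerowicz-sharp graph. If the degree function $\deg_G$ is constant on (the vertex set of) every connected component of $G_{\mathrm{vis}}$, then $G$ is a hypercube bundle.
   Context: All graphs are finite, simple and unweighted; $G=(V,E)$ is connected. The (non-normalized) Laplacian is $Lh(x)=\sum_{y\sim x}(h(y)-h(x))$; the eigenvalues of $-L$ are $0=\lambda_0<\lambda_1\le\lambda_2\le\cdots$ with multiplicity. For functions $f,g:V\to\mathbb R$, $\Gamma(f,g)(x)=\frac12\sum_{y\sim x}(f(y)-f(x))(g(y)-g(x))$, $\Gamma_2(f,g)=\frac12(L\Gamma(f,g)-\Gamma(g,Lf)-\Gamma(f,Lg))$, $\Gamma(f)=\Gamma(f,f)$, $\Gamma_2(f)=\Gamma_2(f,f)$. $G$ satisfies $\mathrm{CD}(K,\infty)$ if $\Gamma_2(f)(x)\ge K\,\Gamma(f)(x)$ for all $f:V\to\mathbb R$ and all $x\in V$. $G$ is Lichnerowicz-sharp if for some $K>0$ it satisfies $\mathrm{CD}(K,\infty)$ and $\lambda_1(G)=K$ (by a known earlier theorem, then necessarily $K=2$). Put $E_2(G)=\ker(L+2I)$. An edge $xy$ of $G$ is visible if some $a\in E_2(G)$ has $a(x)\ne a(y)$, and collapsed otherwise. $G_{\mathrm{vis}}$ is the spanning subgraph of $G$ whose edges are the visible edges. Graph bundle: let $B,F$ be graphs and let $\sigma$ assign to each oriented edge $(x,y)$ of $B$ an automorphism $\sigma_{xy}\in\mathrm{Aut}(F)$ with $\sigma_{yx}=\sigma_{xy}^{-1}$. The graph $B\square_\sigma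 F$ has vertex set $V(B)\times V(F)$ and edges $(x,u)\sim(y,\sigma_{xy}(u))$ whenever $x\sim y$ in $B$, and $(x,u)\sim(x,v)$ whenever $u\sim v$ in $F$. It is called an $F$-bundle over $B$, with base graph $B$ and fiber graph $F$. The hypercube $H_d$ is the graph on $\mathbb F_2^d$ in which two vertices are adjacent iff they differ in exactly one coordinate. A hypercube bundle is a graph isomorphic to an $H_d$-bundle over some base graph, for some $d\ge1$. *)

(* Defs.v *)
From HB Require Import structures.
From mathcomp Require Import all_boot all_order all_fingroup all_algebra.
From mathcomp Require Import boolp reals.

Set Implicit Arguments.
Unset Strict Implicit.
Unset Printing Implicit Defensive.

Import Order.TTheory GRing.Theory Num.Theory.
Local Open Scope ring_scope.

Record sgraph := SGraph {
  svertex :> finType;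
  sedge : rel svertex;
  sedge_sym : symmetric sedge;
  sedge_irr : irreflexive sedge }.

Definition connected_graph (G : sgraph) : Prop :=
  (0 < #|G|)%N /\ forall x y : G, connect (@sedge G) x y.

Definition deg (G : sgraph) (x : G) : nat := #|[set y : G | sedge x y]|.

Definition isomorphic (G H : sgraph) : Prop :=
  exists2 f : G -> H, bijective f & forall x y, sedge (f x) (f y) = sedge x y.

Definition lapl (R : realType) (G : sgraph) (h : G -> R) : G -> R :=
  fun x => \sum_(y : G | sedge x y) (h y - h x).

Definition Gamma (R : realType) (G : sgraph) (f g : G -> R) : G -> R :=
  fun x => 2^-1 * \sum_(y : G | sedge x y) (f y - f x) * (g y - g x).

Definition Gamma2 (R : realType) (G : sgraph) (f g : G -> R) : G -> R :=
  fun x => 2^-1 *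
    (lapl (Gamma f g) x - Gamma g (lapl f) x - Gamma f (lapl g) x).

Definition CD (R : realType) (G : sgraph) (K : R) : Prop :=
  forall (f : G -> R) (x : G), K * Gamma f f x <= Gamma2 f f x.

(* The matrix of -L in the basis of indicator functions of the vertices;
   vertices are numbered by [enum_val]. *)
Definition neg_lapl_mx (R : realType) (G : sgraph) : 'M[R]_#|G| :=
  \matrix_(i, j)
    - lapl (fun z : G => (z == enum_val j)%:R) (enum_val i).

(* [s] lists the eigenvalues of -L with multiplicity in nondecreasing order,
   so that the entry of index k is lambda_k. Such an [s] exists (-L is
   symmetric) and is unique. *)
Definition lapl_spectrum (R : realType) (G : sgraph) (s : seq R) : Prop :=
  sorted <=%R s /\
  char_poly (neg_lapl_mx R G) = \prod_(a <- s) ('X - a%:P).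

(* The bound on [size s] excludes the one-vertex graph, which has no
   lambda_1. *)
Definition is_lambda1 (R : realType) (G : sgraph) (l : R) : Prop :=
  exists s : seq R, [/\ lapl_spectrum G s, (1 < size s)%N & s`_1 = l].

Definition Lichnerowicz_sharp (R : realType) (G : sgraph) : Prop :=
  exists K : R, [/\ 0 < K, CD G K & is_lambda1 G K].

Definition in_E2 (R : realType) (G : sgraph) (a : G -> R) : Prop :=
  forall x : G, lapl a x + 2 * a x = 0.

Definition visible (R : realType) (G : sgraph) : rel G :=
  fun x y => sedge x y && `[< exists2 a : G -> R, in_E2 a & a x <> a y >].

Lemma visible_sym (R : realType) (G : sgraph) : symmetric (@visible R G).
Proof.
move=> x y; rewrite /visible sedge_sym; congr (_ && _).
by apply/asboolP/asboolP => -[a aE2 axy]; exists a => // /esym.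
Qed.

Lemma visible_irr (R : realType) (G : sgraph) : irreflexive (@visible R G).
Proof. by move=> x; rewrite /visible sedge_irr. Qed.

Definition Gvis (R : realType) (G : sgraph) : sgraph :=
  SGraph (@visible_sym R G) (@visible_irr R G).

Definition is_automorphism (F : sgraph) (p : {perm F}) : Prop :=
  forall u v : F, sedge (p u) (p v) = sedge u v.

(* A connection sigma lives on the oriented edges of B; here it is a total
   function constrained only at oriented edges, and its other values do not
   affect the bundle. *)
Record connection (B F : sgraph) := Connection {
  transport :> B -> B -> {perm F};
  transport_aut : forall x y : B, sedge x y -> is_automorphism (transport x y);
  transport_inv :
    forall x y : B, sedge x y -> transport y x = ((transport x y)^-1)%g }.

Definition bundle_edge (B F : sgraph) (sigma : connection B F) : rel (B * F) :=
  fun p q => (sedge p.1 q.1 && (q.2 == sigma p.1 q.1 p.2))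
             || ((p.1 == q.1) && sedge p.2 q.2).

Lemma bundle_edge_sym (B F : sgraph) (sigma : connection B F) :
  symmetric (bundle_edge sigma).
Proof.
move=> [x u] [y v]; rewrite /bundle_edge /= eq_sym (sedge_sym u v).
rewrite (sedge_sym y x); congr (_ || _); last by rewrite eq_sym.
case xy: (sedge x y) => //=; rewrite (transport_inv sigma xy).
by rewrite (can2_eq (permK _) (permKV _)) eq_sym.
Qed.

Lemma bundle_edge_irr (B F : sgraph) (sigma : connection B F) :
  irreflexive (bundle_edge sigma).
Proof. by move=> [x u]; rewrite /bundle_edge /= !sedge_irr andbF. Qed.

Definition bundle (B F : sgraph) (sigma : connection B F) : sgraph :=
  SGraph (bundle_edge_sym sigma) (bundle_edge_irr sigma).

Definition hypercube_edge (d : nat) : rel 'rV['F_2]_d :=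
  fun u v => #|[set i | u 0 i != v 0 i]| == 1%N.

Lemma hypercube_edge_sym d : symmetric (@hypercube_edge d).
Proof.
move=> u v; rewrite /hypercube_edge; congr (#|pred_of_set _| == _).
by apply/setP => i; rewrite !inE eq_sym.
Qed.

Lemma hypercube_edge_irr d : irreflexive (@hypercube_edge d).
Proof.
move=> u; rewrite /hypercube_edge (_ : [set i | _] = set0) ?cards0 //.
by apply/setP => i; rewrite !inE eqxx.
Qed.

Definition hypercube (d : nat) : sgraph :=
  SGraph (@hypercube_edge_sym d) (@hypercube_edge_irr d).

Definition hypercube_bundle (G : sgraph) : Prop :=
  exists (d : nat) (B : sgraph) (sigma : connection B (hypercube d)),
    (1 <= d)%N /\ isomorphic G (bundle sigma).

(* Main.v *)
Require Import Defs.
From mathcomp Require Import all_boot all_order all_fingroup all_algebra.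
From mathcomp Require Import boolp reals ring lra.

Set Implicit Arguments.
Unset Strict Implicit.
Unset Printing Implicit Defensive.

Import Order.TTheory GRing.Theory Num.Theory.
Local Open Scope ring_scope.

(** Let f be an eigenfunction of -L for lambda_1 = K. Summing the curvature
inequality for f over all vertices gives an equality, so at every vertex f lies
in the kernel of the nonnegative form Gamma2 - K Gamma; written out, [L, [L,
f]] = K^2 f, where f acts by multiplication. The diagonal of this identity
gives K = 2, and the degree hypothesis turns it into [A, [A, f]] = 4 f for the
adjacency matrix A. Contracting the latter with A and with A^2 shows that f is
harmonic for two edge weights: the number n_xy of common neighbours, and a
weight that CD(2, oo) forces to be nonnegative on edges xy with f x <> f y.
Both weights therefore vanish on these edges, that is, n_xy = 0, and n_xz = 2
for every neighbour z <> x of y.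

Hence a path x, y, z with f x <> f y and z <> x lies in a unique 4-cycle x, y,
z, y', and f x + f z = f y + f y'. Orienting edges by increasing f, the
vertices above a source r are in bijection with the sets of out-neighbours of
r; these cubes are the fibres, and the edges on which f is constant form the
connection. *)

(** * Cardinality comparisons for finite sets *)

Lemma leq_card_rel (T : finType) (A B : {set T}) (r : rel T) :
  (forall a, a \in A -> exists2 b, b \in B & r a b) ->
  (forall a a' b, a \in A -> a' \in A -> b \in B ->
     r a b -> r a' b -> a = a') ->
  (#|A| <= #|B|)%N.
Proof.
move=> rex rinj; pose g a := odflt a [pick b in B | r a b].
have gP a : a \in A -> (g a \in B) && r a (g a).
  move=> /rex[b bB rab]; rewrite /g; case: pickP => [c //|/(_ b)].
  by rewrite bB rab.
rewrite -(card_in_imset (f := g)); last first.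
  move=> a a' aA a'A eg; have /andP[gB ra] := gP _ aA.
  by have /andP[_ ra'] := gP _ a'A; apply: (rinj a a' (g a)); rewrite // eg.
by apply/subset_leq_card/subsetP => _ /imsetP[a /gP/andP[gB _] ->].
Qed.

(** The intersection is a proper subset of [X] containing [E], so it has [m] elements. It is applied
    to atom sets of two vertices with a common lower neighbour. *)
Lemma setI_subcard (T : finType) (X Y E : {set T}) m :
  E \subset X -> E \subset Y -> #|E| = m -> #|X| = m.+1 -> #|Y| = m.+1 ->
  X != Y -> X :&: Y = E /\ #|X :\: Y| = 1%N.
Proof.
move=> EX EY cE cX cY XY.
have EXY : E \subset X :&: Y by rewrite subsetI EX.
have cI : #|X :&: Y| = m.
  apply/eqP; rewrite eqn_leq -{2}cE subset_leq_card // andbT -ltnS -cX.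
  apply: proper_card; rewrite properEneq subsetIl andbT.
  apply: contraNneq XY => /setIidPl XsY.
  by rewrite eqEcard XsY cX cY leqnn.
split; first by apply/esym/eqP; rewrite eqEcard EXY cE cI leqnn.
by apply/eqP; have /eqP := cardsID Y X; rewrite cI cX -addn1 eqn_add2l.
Qed.

(** * Height functions whose non-flat paths complete to squares *)

Section Height.
Variables (R : realFieldType) (G : sgraph).
Implicit Types (f : G -> R) (b c w x y z : G).

(** Everything the combinatorial half uses about [f]. The relation on values says that opposite
    sides of the 4-cycle have equal increments, so an up edge faces an up edge and a flat edge faces
    a flat edge. *)
Definition squares f : Prop := forall x y z : G,
  sedge x y -> f x != f y -> sedge y z -> z != x ->
  exists2 y', y' != y &
    [/\ sedge x y', sedge y' z, f x + f z = f y + f y' &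
        forall w, sedge x w -> sedge w z -> w = y \/ w = y'].

Definition up f : rel G := fun x y => sedge x y && (f x < f y).
Definition flat f : rel G := fun x y => sedge x y && (f x == f y).
Definition down_set f y := [set x | up f x y].
Definition up_set f x := [set y | up f x y].

Lemma up_opp f x y : up (fun z => - f z) x y = up f y x.
Proof. by rewrite /up sedge_sym ltrN2. Qed.

Lemma down_set_opp f y : down_set (fun z => - f z) y = up_set f y.
Proof. by apply/setP => x; rewrite !inE up_opp. Qed.

(** The relation on values is linear in [f]. Passing to [- f] reverses the orientation, so facts
    about up-neighbours follow from facts about down-neighbours. *)
Lemma squares_opp f : squares f -> squares (fun z => - f z).
Proof.
move=> sq x y z xy fxy yz zx; rewrite eqr_opp in fxy.
have [y' y'y [? ? e ?]] := sq _ _ _ xy fxy yz zx.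
by exists y' => //; split=> //; rewrite -!opprD e.
Qed.

Lemma up_sedge f x y : up f x y -> sedge x y.
Proof. by case/andP. Qed.

Lemma up_sedgeC f x y : up f x y -> sedge y x.
Proof. by rewrite sedge_sym; case/andP. Qed.

Lemma up_lt f x y : up f x y -> f x < f y.
Proof. by case/andP. Qed.

Lemma flatC f : symmetric (flat f).
Proof. by move=> x y; rewrite /flat sedge_sym eq_sym. Qed.

Lemma sedge_cases f x y : sedge x y -> [\/ flat f x y, up f x y | up f y x].
Proof.
rewrite /flat /up (sedge_sym y) => ->.
by case: ltgtP => _; [constructor 2|constructor 3|constructor 1].
Qed.

(** * Diamonds, chains and the in-degree as a rank *)

Section Squares.
Variables (f : G -> R) (sq : squares f).

Lemma down_diamond c u w : up f c w -> up f u w -> c != u ->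
  exists b, [/\ up f b c, up f b u &
    forall t, sedge c t -> sedge t u -> t = w \/ t = b].
Proof.
move=> /andP[cw fcw] /andP[uw fuw] cu; rewrite sedge_sym in uw.
rewrite eq_sym in cu.
have [b bw [cb bu e P]] := sq cw (negbT (lt_eqF fcw)) uw cu.
by exists b; rewrite /up bu (sedge_sym b c) cb /=; split => //; lra.
Qed.

Lemma up_chain b c w : up f b c -> up f c w ->
  exists2 u, u != c & [/\ up f b u, up f u w &
    forall t, sedge b t -> sedge t w -> t = c \/ t = u].
Proof.
move=> /andP[bc fbc] /andP[cw fcw].
have wb : w != b by apply: contraTneq fbc => <-; rewrite -leNgt ltW.
have [u uc [bu uw e P]] := sq bc (negbT (lt_eqF fbc)) cw wb.
by exists u => //; rewrite /up bu uw /=; split => //; lra.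
Qed.

Lemma flat_square x x' y : flat f x x' -> sedge x y -> f x != f y ->
  exists y', [/\ flat f y y', sedge x' y', f y' = f y &
    forall t, sedge y t -> sedge t x' -> t = x \/ t = y'].
Proof.
move=> /andP[xx' /eqP fxx'] xy fxy; rewrite sedge_sym in xy.
rewrite eq_sym in fxy.
have x'y : x' != y by apply: contraNneq fxy => <-; rewrite fxx'.
have [y' _ [yy' y'x' e P]] := sq xy fxy xx' x'y.
exists y'; rewrite /flat yy' sedge_sym y'x'.
by split=> //=; [apply/eqP|]; lra.
Qed.

(** The squares [b, x, y, u] match the down-neighbours [u != x] of [y] with the down-neighbours [b]
    of [x]; uniqueness of the fourth vertex gives injectivity both ways. *)
Lemma card_down_up x y : up f x y -> #|down_set f y| = #|down_set f x|.+1.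
Proof.
move=> xy; rewrite (cardsD1 x) inE xy add1n; congr _.+1.
apply/eqP; rewrite eqn_leq; apply/andP; split.
  apply: (leq_card_rel (r := fun u b => up f b u)).
    move=> u; rewrite !inE => /andP[ux uy].
    by have [b [bu bx _]] := down_diamond uy xy ux; exists b; rewrite ?inE.
  move=> u u' b; rewrite !inE => /andP[ux uy] /andP[u'x u'y] bx bu bu'.
  have [v vx [_ _ P]] := up_chain bx xy.
  have [e|->] := P _ (up_sedge bu) (up_sedge uy); first by rewrite e eqxx in ux.
  have [e|-> //] := P _ (up_sedge bu') (up_sedge u'y).
  by rewrite e eqxx in u'x.
apply: (leq_card_rel (r := fun b u => up f b u)).
  move=> b; rewrite inE => bx; have [u ux [bu uy _]] := up_chain bx xy.
  by exists u; rewrite ?inE ?ux.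
move=> b b' u; rewrite !inE => bx b'x /andP[ux uy] bu b'u.
rewrite eq_sym in ux; have [v [_ _ P]] := down_diamond xy uy ux.
have nle t : up f t x -> t <> y.
  by move=> /up_lt tx e; move: tx (up_lt xy); rewrite e; lra.
have [/(nle _ bx) //|->] := P _ (up_sedgeC bx) (up_sedge bu).
by have [/(nle _ b'x) //|->] := P _ (up_sedgeC b'x) (up_sedge b'u).
Qed.

Lemma leq_card_down_flat x x' :
  flat f x x' -> (#|down_set f x| <= #|down_set f x'|)%N.
Proof.
move=> xx'; have fxx' : f x = f x' by case/andP: xx' => _ /eqP.
apply: (leq_card_rel (r := flat f)).
  move=> y; rewrite inE => /andP[yx fyx]; rewrite sedge_sym in yx.
  have [y' [yy' x'y' fy' _]] := flat_square xx' yx (negbT (gt_eqF fyx)).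
  by exists y' => //; rewrite inE /up sedge_sym x'y' fy' -fxx'.
move=> y z t; rewrite !inE => /andP[yx fyx] /andP[zx fzx] /andP[tx' ftx'].
move=> /andP[yt /eqP fyt] /andP[zt /eqP fzt]; rewrite sedge_sym in tx'.
rewrite flatC in xx'; rewrite sedge_sym in yt; rewrite sedge_sym in zt.
have [t' [_ _ _ P]] := flat_square xx' tx' (negbT (gt_eqF ftx')).
have [e|->] := P _ yt yx; first by move: fyx; rewrite e fxx' ltxx.
by have [e|-> //] := P _ zt zx; move: fzx; rewrite e fxx' ltxx.
Qed.

End Squares.

(** * Descending paths and their unique roots *)

Section Components.
Variables (f : G -> R) (sq : squares f).

Let sq' := squares_opp sq.
Local Notation rank x := #|down_set f x|.

Lemma up_diamond b c u : up f b c -> up f b u -> c != u ->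
  exists w, [/\ up f c w, up f u w &
    forall t, sedge c t -> sedge t u -> t = b \/ t = w].
Proof.
rewrite -!(up_opp f) => bc bu cu.
have [w [cw uw P]] := down_diamond sq' bc bu cu.
by exists w; rewrite -!(up_opp f).
Qed.

Lemma card_up_up x y : up f x y -> #|up_set f x| = #|up_set f y|.+1.
Proof. by rewrite -up_opp -!down_set_opp; apply: card_down_up. Qed.

Lemma card_down_flat x x' : flat f x x' -> rank x = rank x'.
Proof.
move=> xx'; have x'x := xx'; rewrite flatC in x'x.
by apply/eqP; rewrite eqn_leq !(leq_card_down_flat sq).
Qed.

Lemma card_up_flat x x' : flat f x x' -> #|up_set f x| = #|up_set f x'|.
Proof.
move=> xx'; have x'x := xx'; rewrite flatC in x'x.
have opp s t : flat f s t -> flat (fun z => - f z) s t.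
  by rewrite /flat eqr_opp.
by apply/eqP; rewrite -!down_set_opp eqn_leq !(leq_card_down_flat sq') ?opp.
Qed.

(** Crossing an up edge trades one out-neighbour for one in-neighbour. On a connected graph the sum
    is thus constant; it will be the dimension of the cubes. *)
Lemma card_up_down_sedge x y : sedge x y ->
  (#|up_set f x| + rank x = #|up_set f y| + rank y)%N.
Proof.
case/(sedge_cases f) => [xy|xy|yx].
- by rewrite (card_up_flat xy) (card_down_flat xy).
- by rewrite (card_up_up xy) (card_down_up sq xy) addSnnS.
- by rewrite (card_up_up yx) (card_down_up sq yx) addSnnS.
Qed.

(** Paths descend from [w], so unfolding one exposes the step next to [w], as inductions on rank
    require. *)
Definition below b w := connect (fun x y => up f y x) w b.

Lemma below_refl w : below w w.
Proof. exact: connect0. Qed.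

Lemma below_trans b c w : below b c -> below c w -> below b w.
Proof. by move=> bc cw; apply: connect_trans cw bc. Qed.

Lemma up_below b w : up f b w -> below b w.
Proof. by move=> bw; apply: connect1. Qed.

Lemma below_inv b w : below b w -> b = w \/ exists2 c, up f c w & below b c.
Proof.
case/connectP => -[|c p] /= => [_ ->|]; first by left.
by move=> /andP[cw cp] e; right; exists c => //; apply/connectP; exists p.
Qed.

Lemma down_ex w n : rank w = n.+1 -> exists2 c, up f c w & rank c = n.
Proof.
move=> rw; have /card_gt0P[c] : (0 < rank w)%N by rewrite rw.
rewrite inE => cw; exists c => //.
by move: rw; rewrite (card_down_up sq cw) => -[].
Qed.

Lemma rank_up n c w : rank w = n.+1 -> up f c w -> rank c = n.
Proof. by move=> rw /(card_down_up sq); rewrite rw => -[]. Qed.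

Lemma rank0N c w : rank w = 0%N -> up f c w = false.
Proof.
by move=> r0; apply: contra_eqF r0 => /(card_down_up sq) ->.
Qed.

Lemma root_ex w : exists2 r, rank r = 0%N & below r w.
Proof.
have [n] := ubnP (rank w); elim: n w => // n IH w.
case rw: (rank w) => [|m] lt; first by exists w => //; apply: below_refl.
have [c cw rc] := down_ex rw; have [|r r0 rbc] := IH c; first by rewrite rc.
by exists r => //; apply: below_trans rbc (up_below cw).
Qed.

(** Confluence, as in Newman's lemma: two down-neighbours of [w] have a common down-neighbour [b],
    and by induction a root below [b] is the only root below either of them. *)
Lemma root_unique r r' w : rank r = 0%N -> rank r' = 0%N ->
  below r w -> below r' w -> r = r'.
Proof.
have atroot s t : rank t = 0%N -> below s t -> s = t.
  by move=> t0 /below_inv[//|[c]]; rewrite rank0N.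
have [n] := ubnP (rank w); elim: n w r r' => // n IH w r r' lt r0 r'0 rw r'w.
have [er|[c cw rc]] := below_inv rw.
  by rewrite -er in r'w; rewrite (atroot _ _ r0 r'w).
have [er'|[c' c'w r'c']] := below_inv r'w.
  by rewrite -er' in rw; rewrite (atroot _ _ r'0 rw).
have ltc d : up f d w -> (rank d < n)%N.
  by move=> /(card_down_up sq) e; move: lt; rewrite e ltnS.
have [ecc'|ncc'] := eqVneq c c'.
  by apply: (IH c) => //; [exact: ltc|rewrite ecc'].
have [b [bc bc' _]] := down_diamond sq cw c'w ncc'.
have [s s0 sb] := root_ex b.
have sc := below_trans sb (up_below bc).
have sc' := below_trans sb (up_below bc').
by rewrite (IH c r s (ltc _ cw)) // (IH c' s r' (ltc _ c'w)).
Qed.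

(** * Atoms below a vertex *)

Definition atoms w := [set a | (rank a == 1%N) && below a w].

Lemma atoms_below b w : below b w -> atoms b \subset atoms w.
Proof.
move=> bw; apply/subsetP => a; rewrite !inE => /andP[-> ab].
exact: below_trans ab bw.
Qed.

Lemma atoms_up b w : up f b w -> atoms b \subset atoms w.
Proof. by move=> /up_below /atoms_below. Qed.

Lemma atoms_rank0 w : rank w = 0%N -> atoms w = set0.
Proof.
move=> w0; apply/setP => a; rewrite !inE; apply/andP => -[/eqP a1 /below_inv].
by case=> [e|[c]]; [rewrite e w0 in a1|rewrite rank0N].
Qed.

Lemma atoms_rank1 w : rank w = 1%N -> atoms w = [set w].
Proof.
move=> w1; apply/setP => a; rewrite !inE; apply/andP/eqP => [|->]; last first.
  by rewrite w1 below_refl.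
case=> a1 /below_inv[//|[c cw ac]]; have /atoms_rank0/setP/(_ a) := rank_up w1 cw.
by rewrite !inE a1 ac.
Qed.

(** The two claims need each other: counting atoms at rank [n] uses separation at lower ranks, and
    separation at rank [n] uses the count at rank [n]. *)
Lemma atoms_step n :
  (forall w, rank w = n -> #|atoms w| = n) /\
  (forall b c u, up f b c -> up f b u -> c != u -> rank c = n ->
     atoms c != atoms u).
Proof.
elim/ltn_ind: n => n IH.
have cardn w : rank w = n -> #|atoms w| = n.
  case: n IH w => [|[|m]] IH w rw.
  - by rewrite (atoms_rank0 rw) cards0.
  - by rewrite (atoms_rank1 rw) cards1.
  have rd u : up f u w -> rank u = m.+1 := rank_up rw.
  have [c cw rc] := down_ex rw.
  have cd u : up f u w -> #|atoms u| = m.+1.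
    by move=> /rd ru; apply: (IH m.+1 _).1.
  (* Each further down-neighbour [u] of [w] adds exactly one atom to those of [c]. *)
  have K u : up f u w -> u != c -> exists b, [/\ up f b u, up f b c,
      atoms u :&: atoms c = atoms b & #|atoms u :\: atoms c| = 1%N].
    move=> uw uc; have [b [bu bc _]] := down_diamond sq uw cw uc.
    have cb : #|atoms b| = m by apply: (IH m _).1; [|apply: rank_up bc].
    have [|eI cD] := setI_subcard (atoms_up bu) (atoms_up bc) cb (cd _ uw) (cd _ cw).
      by apply: ((IH m.+1 _).2 b) => //; apply: rd.
    by exists b.
  have [u0] : exists u, u \in down_set f w :\ c.
    apply/card_gt0P; have := cardsD1 c (down_set f w).
    by rewrite inE cw rw add1n => -[<-].
  rewrite !inE => /andP[u0c u0w]; have [b0 [b0u0 b0c e0 c0]] := K _ u0w u0c.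
  (* That atom does not depend on [u]. If [u] and [u0] added different ones, the atoms of their meet
     [g] would lie below [c], hence coincide with those of [b] and of [b0], two distinct vertices
     over a common [d]: this contradicts separation at rank [m]. *)
  have same u : up f u w -> u != c ->
      atoms u :\: atoms c = atoms u0 :\: atoms c.
    move=> uw uc; have [-> //|uu0] := eqVneq u u0.
    have [b [bu bc e cD]] := K _ uw uc.
    have /eqP/cards1P[q eq] := cD; have /eqP/cards1P[q0 eq0] := c0.
    rewrite eq eq0; have [-> //|qq0] := eqVneq q q0.
    have [g [gu gu0 _]] := down_diamond sq uw u0w uu0.
    have gI a : a \in atoms g -> a \in atoms c.
      move=> ag; have au := subsetP (atoms_up gu) _ ag.
      have au0 := subsetP (atoms_up gu0) _ ag.
      apply: contraNT qq0 => ac.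
      have : a \in atoms u :\: atoms c by rewrite in_setD ac au.
      have : a \in atoms u0 :\: atoms c by rewrite in_setD ac au0.
      by rewrite eq eq0 !in_set1 => /eqP <- /eqP <-.
    have gb : atoms g \subset atoms b.
      by rewrite -e subsetI (atoms_up gu); apply/subsetP.
    have gb0 : atoms g \subset atoms b0.
      by rewrite -e0 subsetI (atoms_up gu0); apply/subsetP.
    have cm x y : up f x y -> up f y w -> #|atoms x| = m.
      by move=> xy /rd ry; apply: (IH m _).1; [|apply: rank_up xy].
    have egb : atoms g == atoms b by rewrite eqEcard gb (cm b u) // (cm g u) // ?leqnn.
    have egb0 : atoms g == atoms b0.
      by rewrite eqEcard gb0 (cm b0 u0) // (cm g u) // leqnn.
    have bb0 : b != b0.
      apply: contraNneq uu0 => ebb0; rewrite -ebb0 in b0u0.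
      have [v _ [_ _ P]] := up_chain sq bc cw.
      have [euc|->] := P _ (up_sedge bu) (up_sedge uw).
        by rewrite euc eqxx in uc.
      have [euc|->//] := P _ (up_sedge b0u0) (up_sedge u0w).
      by rewrite euc eqxx in u0c.
    have [d [db db0 _]] := down_diamond sq bc b0c bb0.
    have := (IH m (ltnW (ltnSn _))).2 d b b0 db db0 bb0 (rank_up rc bc).
    by rewrite -(eqP egb) -(eqP egb0) eqxx.
  have -> : atoms w = atoms c :|: atoms u0.
    apply/eqP; rewrite eqEsubset subUset !atoms_up // !andbT.
    apply/subsetP => a aw; have := aw.
    rewrite inE => /andP[a1 /below_inv[e|[u uw au]]].
      by move: a1; rewrite e rw.
    have {}au : a \in atoms u by rewrite inE a1.
    rewrite in_setU; have [<-|uc] := eqVneq u c; first by rewrite au.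
    case ac: (a \in atoms c) => //=.
    have : a \in atoms u :\: atoms c by rewrite in_setD ac au.
    by rewrite same // in_setD => /andP[].
  by rewrite -(cardsID (atoms c)) setUK setDUl setDv set0U c0 cd ?addn1.
(* Separation: push [c] and [u] down along the edge from [e] to [b], getting [c1] and [u1]. Each
   adds to the atoms of [e] the one atom that [c], respectively [u], adds to those of [b], so equal
   atoms above force equal atoms of [c1] and [u1]. *)
split=> // b c u bc bu cu rc.
have ru : rank u = n by rewrite (card_down_up sq bu) -(card_down_up sq bc).
case: n IH cardn rc ru => [|[|m]] IH cardn rc ru.
- by rewrite rank0N in bc.
- by rewrite !atoms_rank1 // (inj_eq set1_inj).
have rb := rank_up rc bc; have [e eb re] := down_ex rb.
have [c1 c1b [ec1 c1c P1]] := up_chain sq eb bc.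
have [u1 u1b [eu1 u1u P2]] := up_chain sq eb bu.
(* Otherwise [c] and [u] would both be the top of the diamond over [e] spanned by [b] and [c1]. *)
have c1u1 : c1 != u1.
  apply: contraNneq cu => e1; rewrite -e1 in u1u.
  rewrite eq_sym in c1b; have [w [_ _ P]] := up_diamond eb ec1 c1b.
  have ne t : up f b t -> t <> e.
    by move=> /up_lt bt et; move: bt (up_lt eb); rewrite et; lra.
  have [/(ne _ bc) //|->] := P _ (up_sedge bc) (up_sedgeC c1c).
  by have [/(ne _ bu) //|->] := P _ (up_sedge bu) (up_sedgeC u1u).
have rc1 := rank_up rc c1c; have ru1 := rank_up ru u1u.
have IH1 := IH m.+1 (ltnSn _).
have [ce cb cc1 cu1] : [/\ #|atoms e| = m, #|atoms b| = m.+1,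
    #|atoms c1| = m.+1 & #|atoms u1| = m.+1].
  by split; [apply: (IH m _).1|apply: IH1.1|apply: IH1.1|apply: IH1.1].
have [eI1 cD1] := setI_subcard (atoms_up ec1) (atoms_up eb) ce cc1 cb
  (IH1.2 _ _ _ ec1 eb c1b rc1).
have [eI2 cD2] := setI_subcard (atoms_up eu1) (atoms_up eb) ce cu1 cb
  (IH1.2 _ _ _ eu1 eb u1b ru1).
apply/negP => /eqP ecu.
have cD : #|atoms c :\: atoms b| = 1%N.
  have := cardsID (atoms b) (atoms c).
  by rewrite (setIidPr (atoms_up bc)) cb cardn // -(addn1 m.+1) => /addnI.
have D1 : atoms c1 :\: atoms b = atoms c :\: atoms b.
  by apply/eqP; rewrite eqEcard setSD ?atoms_up // cD1 cD.
have D2 : atoms u1 :\: atoms b = atoms c :\: atoms b.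
  by apply/eqP; rewrite eqEcard ecu setSD ?atoms_up // -ecu cD2 cD.
have := IH1.2 _ _ _ ec1 eu1 c1u1 rc1.
by rewrite -(setID (atoms c1) (atoms b)) -(setID (atoms u1) (atoms b)) eI1 eI2 D1 D2 eqxx.
Qed.

Lemma card_atoms w : #|atoms w| = rank w.
Proof. exact: (atoms_step _).1. Qed.

Lemma atoms_up_inj b c u : up f b c -> up f b u -> atoms c = atoms u -> c = u.
Proof.
by move=> bc bu; apply: contra_eq => cu; apply: (atoms_step _).2 bc bu cu erefl.
Qed.

Lemma atoms_down_inj w c u : up f c w -> up f u w -> atoms c = atoms u -> c = u.
Proof.
move=> cw uw; have [//|cu] := eqVneq c u.
by have [b [bc bu _]] := down_diamond sq cw uw cu; apply: atoms_up_inj bc bu.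
Qed.

Lemma card_below b w : below b w ->
  (#|up_set f w| + rank w = #|up_set f b| + rank b)%N.
Proof.
case/connectP => p; elim: p w => [w _ -> //|c p IH w /= /andP[cw cp] eb].
by rewrite -(IH c cp eb) (card_up_down_sedge (up_sedge cw)).
Qed.

(** * The vertices over a root as a Boolean lattice of atom sets *)

(** By existence and uniqueness of the root, this labels the cube containing [w]. *)
Definition rt w := odflt w [pick r | (rank r == 0%N) && below r w].

Lemma rt_rank w : rank (rt w) = 0%N.
Proof.
rewrite /rt; case: pickP => [r /andP[/eqP] //|].
by have [r r0 rw] := root_ex w => /(_ r); rewrite r0 rw.
Qed.

Lemma rt_below w : below (rt w) w.
Proof.
rewrite /rt; case: pickP => [r /andP[_] //|].
by have [r r0 rw] := root_ex w => /(_ r); rewrite r0 rw.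
Qed.

Lemma rt_eq r w : rank r = 0%N -> below r w -> rt w = r.
Proof. by move=> r0; apply: root_unique (rt_below w); rewrite ?rt_rank. Qed.

Lemma rt_id r : rank r = 0%N -> rt r = r.
Proof. by move=> r0; apply: rt_eq r0 (below_refl r). Qed.

Lemma rt_up c w : up f c w -> rt c = rt w.
Proof.
move=> cw; apply/esym/rt_eq; first exact: rt_rank.
exact: below_trans (rt_below c) (up_below cw).
Qed.

Lemma rt_sedge x y : sedge x y -> f x != f y -> rt x = rt y.
Proof.
move=> /(sedge_cases f)[/andP[_ ->] //|/rt_up //|/rt_up //].
Qed.

Lemma atoms_sub_root w : atoms w \subset up_set f (rt w).
Proof.
apply/subsetP => a; rewrite !inE => /andP[/eqP a1 aw].
have [c ca c0] := down_ex a1.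
by rewrite (rt_eq c0 (below_trans (up_below ca) aw)).
Qed.

Lemma subset_codim1 (X Y : {set G}) : X \subset Y -> #|Y| = #|X|.+1 ->
  exists a, [/\ a \in Y, a \notin X, X = Y :\ a & Y = a |: X].
Proof.
move=> XY cY; have : #|Y :\: X| == 1%N.
  by have := cardsID X Y; rewrite (setIidPr XY) cY -addn1 => /addnI ->.
move=> /cards1P[a eD]; have : a \in Y :\: X by rewrite eD set11.
rewrite in_setD => /andP[aX aY]; exists a.
have eX : X = Y :\ a.
  by apply/eqP; rewrite -eD setDDr setDv set0U eq_sym; apply/eqP/setIidPr.
by split=> //; rewrite eX setD1K.
Qed.

(** Counting: [w] has [rank w] down-neighbours with distinct atom sets, each omitting one of the
    [rank w] atoms of [w], so every such set occurs. *)
Lemma atoms_down_full w (X : {set G}) : X \subset atoms w -> rank w = #|X|.+1 ->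
  exists2 c, up f c w & atoms c = X.
Proof.
move=> Xw rw; pose J := [set atoms w :\ a | a in atoms w].
have IJ : atoms @: down_set f w \subset J.
  apply/subsetP => Z /imsetP[c]; rewrite inE => cw ->.
  have [|a [aw _ e _]] := subset_codim1 (atoms_up cw).
    by rewrite !card_atoms (card_down_up sq cw).
  by apply/imsetP; exists a.
have /eqP eJ : atoms @: down_set f w == J.
  rewrite eqEcard IJ (leq_trans (leq_imset_card _ _)) // card_atoms.
  rewrite card_in_imset // => c u; rewrite !inE; exact: atoms_down_inj.
have : X \in J.
  have [|a [aw _ e _]] := subset_codim1 Xw; first by rewrite card_atoms.
  by apply/imsetP; exists a.
by rewrite -eJ => /imsetP[c]; rewrite inE => cw ->; exists c.
Qed.

(** The dual count: by [card_below], [x] has as many up-neighbours as its root has out-neighbours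
    outside [atoms x]. *)
Lemma atoms_up_full x (X : {set G}) : atoms x \subset X -> X \subset up_set f (rt x) ->
  #|X| = (rank x).+1 -> exists2 y, up f x y & atoms y = X.
Proof.
move=> xX Xr cX; pose U := up_set f (rt x).
pose J := [set a |: atoms x | a in U :\: atoms x].
have IJ : atoms @: up_set f x \subset J.
  apply/subsetP => Z /imsetP[y]; rewrite inE => xy ->.
  have [|a [ay ax _ e]] := subset_codim1 (atoms_up xy).
    by rewrite !card_atoms (card_down_up sq xy).
  apply/imsetP; exists a; rewrite // in_setD ax /U (rt_up xy).
  exact: subsetP (atoms_sub_root y) _ ay.
have /eqP eJ : atoms @: up_set f x == J.
  rewrite eqEcard IJ (leq_trans (leq_imset_card _ _)) //.
  rewrite card_in_imset; last first.
    by move=> c u; rewrite !inE; apply: atoms_up_inj.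
  rewrite cardsD (setIidPr (atoms_sub_root x)) card_atoms leq_subLR addnC.
  by rewrite (card_below (rt_below x)) rt_rank addn0.
have : X \in J.
  have [|a [aX ax _ e]] := subset_codim1 xX; first by rewrite card_atoms.
  by apply/imsetP; exists a; rewrite // in_setD ax (subsetP Xr).
by rewrite -eJ => /imsetP[y]; rewrite inE => xy ->; exists y.
Qed.

(** By induction on rank, [x] and [y] share a down-neighbour [c]; two vertices above [c] with equal
    atoms agree. *)
Lemma atoms_inj x y : rt x = rt y -> atoms x = atoms y -> x = y.
Proof.
have [n] := ubnP (rank x); elim: n x y => // n IH x y lt er ea.
have rxy : rank x = rank y by rewrite -!card_atoms ea.
case rx: (rank x) => [|m].
  by rewrite -(rt_id rx) er rt_id // -rxy.
have [c cx rc] := down_ex rx.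
have [||c' c'y ec] := @atoms_down_full y (atoms c).
- by rewrite -ea atoms_up.
- by rewrite card_atoms -rxy (card_down_up sq cx).
have ecc' : c = c'.
  apply: IH; rewrite ?rc //; first by rewrite -ltnS -rx.
  by rewrite (rt_up cx) er (rt_up c'y).
by rewrite -ecc' in c'y; apply: atoms_up_inj cx c'y ea.
Qed.

Lemma atoms_surj r (S : {set G}) : rank r = 0%N -> S \subset up_set f r ->
  exists2 x, rt x = r & atoms x = S.
Proof.
move=> r0; have [n] := ubnP #|S|; elim: n S => // n IH S lt Sr.
have [->|[a aS]] := set_0Vmem S.
  by exists r; [apply: rt_id|apply: atoms_rank0].
have [||x rx ex] := IH (S :\ a).
- by move: lt; rewrite (cardsD1 a S) aS.
- exact: subset_trans (subD1set _ _) Sr.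
have [|||y xy ey] := @atoms_up_full x S.
- by rewrite ex subD1set.
- by rewrite rx.
- by rewrite -card_atoms ex (cardsD1 a S) aS.
by exists y; rewrite // -(rt_up xy).
Qed.

(** Stated through both differences, so that symmetrising it says that the symmetric difference has
    one element. *)
Lemma up_atoms x y : rt x = rt y ->
  up f x y = (#|atoms x :\: atoms y| == 0%N) && (#|atoms y :\: atoms x| == 1%N).
Proof.
move=> er; apply/idP/andP => [xy|[]].
  rewrite cards_eq0 setD_eq0 atoms_up //; split=> //.
  have := cardsID (atoms x) (atoms y).
  rewrite (setIidPr (atoms_up xy)) !card_atoms (card_down_up sq xy) -addn1.
  by move=> /addnI ->.
rewrite cards_eq0 setD_eq0 => xy /eqP c1.
have [//||c cy ec] := @atoms_down_full y (atoms x).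
  by rewrite -card_atoms -(cardsID (atoms x)) (setIidPr xy) c1 addn1.
by rewrite -(@atoms_inj c x) // (rt_up cy).
Qed.

(** * Flat edges between cubes *)

(** Flat squares slide the edge down one rank at a time until it joins the two roots. *)
Lemma flat_rt x x' : flat f x x' -> flat f (rt x) (rt x').
Proof.
have [n] := ubnP (rank x); elim: n x x' => // n IH x x' lt xx'.
case rx: (rank x) => [|m].
  by rewrite !rt_id // -(card_down_flat xx').
have [c cx rc] := down_ex rx.
have := up_lt cx => fcx; have fxx' : f x = f x' by case/andP: xx' => _ /eqP.
have [c' [cc' x'c' fc' _]] :=
  flat_square sq xx' (up_sedgeC cx) (negbT (gt_eqF fcx)).
have c'x' : up f c' x' by rewrite /up sedge_sym x'c' fc' -fxx'.
rewrite -(rt_up cx) -(rt_up c'x'); apply: IH => //.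
by rewrite rc -ltnS -rx.
Qed.

(** A flat edge inside one cube would slide down to a loop at its root. *)
Lemma rt_eq_sedge x y : rt x = rt y -> sedge x y = up f x y || up f y x.
Proof.
move=> er; apply/idP/orP => [/(sedge_cases f)[/flat_rt|xy|yx]|].
- by rewrite er /flat sedge_irr.
- by left.
- by right.
by case=> [/up_sedge|/up_sedgeC].
Qed.

Lemma rt_neq_sedge x y : rt x != rt y -> sedge x y -> flat f x y.
Proof.
by move=> ne /(sedge_cases f)[//|/rt_up|/rt_up] e; rewrite e eqxx in ne.
Qed.

(* Induct along a path from y down to its root: each square determines the next
one. *)
Lemma flat_unique y z z' : flat f y z -> flat f y z' -> rt z = rt z' -> z = z'.
Proof.
have [n] := ubnP (rank y); elim: n y z z' => // n IH y z z' lt yz yz' er.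
case ry: (rank y) => [|m].
  by rewrite -(rt_id (_ : rank z = 0%N)) ?er ?rt_id // -?(card_down_flat yz')
    -?(card_down_flat yz).
have [x xy rx] := down_ex ry; have fxy := up_lt xy.
have ny := negbT (gt_eqF fxy).
have [fyz fyz'] : f y = f z /\ f y = f z'.
  by split; [case/andP: yz => _ /eqP|case/andP: yz' => _ /eqP].
have [x1 [xx1 zx1 fx1 _]] := flat_square sq yz (up_sedgeC xy) ny.
have [x2 [xx2 zx2 fx2 _]] := flat_square sq yz' (up_sedgeC xy) ny.
have e12 : x1 = x2.
  apply: (IH x) => //; first by rewrite rx -ltnS -ry.
  rewrite -(rt_sedge zx1) ?er; last by rewrite fx1 -fyz.
  by rewrite (rt_sedge zx2) // fx2 -fyz'.
rewrite -e12 in zx2.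
have [y' [_ _ _ P]] :=
  flat_square sq xx1 (up_sedge xy) (negbT (lt_eqF fxy)).
have nx t : f y = f t -> t <> x by move=> ft et; move: fxy; rewrite ft et ltxx.
have [/(nx _ fyz) //|->] := P z (proj1 (andP yz)) zx1.
by have [/(nx _ fyz') //|->] := P z' (proj1 (andP yz')) zx2.
Qed.

(** Flat squares lift the edge [r r'] step by step along a path from [r] up to [y]. *)
Lemma flat_exists r r' y : flat f r r' -> rank r = 0%N -> rt y = r ->
  exists2 z, rt z = r' & flat f y z.
Proof.
move=> rr' r0; have r'0 : rank r' = 0%N by rewrite -(card_down_flat rr').
have [n] := ubnP (rank y); elim: n y => // n IH y lt ery.
case ry: (rank y) => [|m].
  by exists r'; [exact: rt_id|rewrite -(rt_id ry) ery].
have [x xy rx] := down_ex ry; have fxy := up_lt xy.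
have [||x' rx' xx'] := IH x; [by rewrite rx -ltnS -ry|by rewrite (rt_up xy)|].
have [z [yz x'z fz _]] := flat_square sq xx' (up_sedge xy) (negbT (lt_eqF fxy)).
exists z => //; rewrite -rx'; apply/esym/rt_sedge => //.
by case/andP: xx' => _ /eqP <-; rewrite fz lt_eqF.
Qed.

(** The flat square on [x'], [x], [y] has its fourth vertex in the cube of [y'], so [flat_unique]
    identifies it with [y']. This makes the transports graph morphisms. *)
Lemma flat_edge x x' y y' : flat f x x' -> flat f y y' ->
  rt x = rt y -> rt x' = rt y' -> sedge x y -> sedge x' y'.
Proof.
move=> xx' yy' er er' xy; have fxy : f x != f y.
  move: (xy); rewrite rt_eq_sedge // => /orP[] /up_lt e.
    by rewrite lt_eqF.
  by rewrite gt_eqF.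
have [y1 [yy1 x'y1 fy1 _]] := flat_square sq xx' xy fxy.
suff -> : y' = y1 by [].
apply: flat_unique yy' yy1 _; rewrite -er'; apply: rt_sedge => //.
by case/andP: xx' => _ /eqP <-; rewrite fy1.
Qed.

(** * Coordinates over the two-element field *)

Section Coordinates.
Variable d : nat.
Hypothesis valency : forall x, (#|up_set f x| + rank x = d)%N.

(** The numberings at different roots are unrelated, so flat edges need not preserve coordinates;
    the connection records the discrepancy. *)
Definition atom_at r (i : 'I_d) : G := nth r (enum (up_set f r)) i.

Lemma size_atoms_root r : rank r = 0%N -> size (enum (up_set f r)) = d.
Proof. by move=> r0; rewrite -cardE -(valency r) r0 addn0. Qed.

Lemma atom_at_inj r : rank r = 0%N -> injective (atom_at r).
Proof.
move=> r0 i j /eqP; rewrite /atom_at nth_uniq ?size_atoms_root ?enum_uniq //.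
by move=> /eqP /val_inj.
Qed.

Lemma atom_at_surj r a : rank r = 0%N -> a \in up_set f r ->
  exists i, a = atom_at r i.
Proof.
move=> r0 ar; have : (index a (enum (up_set f r)) < d)%N.
  by rewrite -(size_atoms_root r0) index_mem mem_enum.
by move=> lt; exists (Ordinal lt); rewrite /atom_at nth_index // mem_enum.
Qed.

Definition coord x : 'rV['F_2]_d := \row_i (atom_at (rt x) i \in atoms x)%:R.

Lemma bool_F2_inj (s t : bool) : (s%:R == t%:R :> 'F_2) = (s == t).
Proof. by case: s t => -[]. Qed.

Lemma coord_inj x y : rt x = rt y -> coord x = coord y -> x = y.
Proof.
move=> er ec; apply: atoms_inj => //; apply/setP => a.
have [/(atom_at_surj (rt_rank x))[i ->]|aU] := boolP (a \in up_set f (rt x)).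
  have /rowP/(_ i)/eqP := ec.
  by rewrite !mxE bool_F2_inj -er => /eqP.
have xa := contraNF (subsetP (atoms_sub_root x) a) aU.
by rewrite xa (contraNF (subsetP (atoms_sub_root y) a)) // -er.
Qed.

Lemma coord_surj r (u : 'rV['F_2]_d) : rank r = 0%N -> exists2 x, rt x = r & coord x = u.
Proof.
move=> r0.
pose S := [set a in up_set f r |
  [exists i, (a == atom_at r i) && (u 0 i == 1)]].
have [|x rx ex] := @atoms_surj r S r0.
  by apply/subsetP => a; rewrite inE => /andP[].
exists x => //; apply/rowP => i; rewrite mxE rx ex inE.
have -> : atom_at r i \in up_set f r.
  by rewrite -mem_enum mem_nth // size_atoms_root.
have -> : [exists j, (atom_at r i == atom_at r j) && (u 0 j == 1)] = (u 0 i == 1).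
  apply/existsP/idP => [[j /andP[/eqP/(atom_at_inj r0)-> //]]|ui].
  by exists i; rewrite eqxx.
by case: (u 0 i) => -[|[|[]]] // ?; apply: val_inj.
Qed.

Lemma coord_sedge x y : rt x = rt y ->
  hypercube_edge (coord x) (coord y) = sedge x y.
Proof.
move=> er; rewrite rt_eq_sedge // !up_atoms // /hypercube_edge.
pose I := [set i | coord x 0 i != coord y 0 i].
have memI i : (i \in I) =
    ((atom_at (rt x) i \in atoms x) != (atom_at (rt x) i \in atoms y)).
  by rewrite in_set !mxE bool_F2_inj -er.
(* The differing coordinates enumerate the symmetric difference of the atom sets. Its two halves are
   disjoint, so total size one means that one is empty and the other a singleton. *)
have eI : atom_at (rt x) @: I = (atoms x :\: atoms y) :|: (atoms y :\: atoms x).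
  apply/setP => a; apply/imsetP/idP => [[i iI ->]|aD].
    move: iI; rewrite in_setU !in_setD memI.
    by do 2![case: (_ \in atoms _)].
  have aU : a \in up_set f (rt x).
    move: aD; rewrite in_setU !in_setD => /orP[]/andP[_].
      exact/subsetP/atoms_sub_root.
    by rewrite er; apply/subsetP/atoms_sub_root.
  have [i ei] := atom_at_surj (rt_rank x) aU; exists i => //.
  move: aD; rewrite ei in_setU !in_setD memI.
  by do 2![case: (_ \in atoms _)].
rewrite -(card_imset _ (@atom_at_inj (rt x) (rt_rank x))) eI.
rewrite cardsU (_ : _ :&: _ = set0) ?cards0 ?subn0.
  by move: #|_ :\: _| #|_ :\: _| => [|[|m]] [|[|n]].
apply/setP => a; rewrite in_setI !in_setD in_set0.
by do 2![case: (_ \in atoms _)].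
Qed.

(** * The base graph on the roots and its connection *)

Definition base_vertex := {r : G | rank r == 0%N}.
Definition base_edge : rel base_vertex := fun r s => sedge (val r) (val s).
Lemma base_edge_sym : symmetric base_edge.
Proof. by move=> r s; apply: sedge_sym. Qed.
Lemma base_edge_irr : irreflexive base_edge.
Proof. by move=> r; apply: sedge_irr. Qed.
Definition base := SGraph base_edge_sym base_edge_irr.

Lemma base_rank (r : base) : rank (val r) = 0%N.
Proof. exact/eqP/(valP r). Qed.

Definition base_of x : base :=
  exist (fun r => rank r == 0%N) (rt x) (introT eqP (rt_rank x)).

Definition chart x : base * hypercube d := (base_of x, coord x).

Definition point (r : base) (u : hypercube d) : G :=
  s2val (cid2 (coord_surj u (base_rank r))).

Lemma rt_point (r : base) (u : hypercube d) : rt (point r u) = val r.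
Proof. exact: s2valP (cid2 (coord_surj u (base_rank r))). Qed.

Lemma coord_point (r : base) (u : hypercube d) : coord (point r u) = u.
Proof. exact: s2valP' (cid2 (coord_surj u (base_rank r))). Qed.

Lemma chart_point (r : base) (u : hypercube d) : chart (point r u) = (r, u).
Proof. by congr (_, _); [apply/val_inj/rt_point|apply: coord_point]. Qed.

Lemma point_chart x : point (base_of x) (coord x) = x.
Proof. by apply: coord_inj; rewrite ?rt_point ?coord_point. Qed.

Lemma base_edge_neq (r s : base) : sedge r s -> val r != val s.
Proof. by apply: contraTneq => /val_inj ->; rewrite sedge_irr. Qed.

Lemma base_edge_flat (r s : base) : sedge r s -> flat f (val r) (val s).
Proof.
by move=> rs; apply: rt_neq_sedge => //; rewrite !rt_id ?base_rank ?base_edge_neq.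
Qed.

Lemma point_flat (r s : base) (u v : hypercube d) : sedge r s ->
  sedge (point r u) (point s v) -> flat f (point r u) (point s v).
Proof. by move=> rs; apply: rt_neq_sedge; rewrite !rt_point base_edge_neq. Qed.

Definition transports (r s : base) (p : {perm hypercube d}) :=
  [forall u, sedge (point r u) (point s (p u))].

Lemma transports_ex r s : sedge r s -> exists p, transports r s p.
Proof.
move=> rs; have ex (u : hypercube d) : exists v, sedge (point r u) (point s v).
  (* The lift of the base edge starting at [point r u] ends in the cube of [s]; its coordinates are
     the image of [u]. *)
  have [z rz /andP[yz _]] :=
    flat_exists (base_edge_flat rs) (base_rank r) (rt_point r u).
  by exists (coord z); rewrite -(_ : z = point s _) //; apply: coord_inj;
    rewrite ?rt_point ?coord_point.
pose p u := xchoose (ex u); have pP u : sedge (point r u) (point s (p u)).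
  exact: (xchooseP (ex u)).
have p_inj : injective p.
  move=> u v puv; rewrite -(coord_point r u) -(coord_point r v); congr coord.
  apply: (@flat_unique (point s (p u))); rewrite ?rt_point //.
    by rewrite flatC point_flat.
  by rewrite flatC puv point_flat.
by exists (perm p_inj); apply/forallP => u; rewrite permE.
Qed.

Lemma transports_unique r s p q :
  sedge r s -> transports r s p -> transports r s q -> p = q.
Proof.
move=> rs /forallP pP /forallP qP; apply/permP => u.
rewrite -(coord_point s (p u)) -(coord_point s (q u)); congr coord.
by apply: (@flat_unique (point r u)); rewrite ?rt_point ?point_flat.
Qed.

Lemma transportsV r s p : transports r s p -> transports s r (p^-1)%g.
Proof.
move=> /forallP pP; apply/forallP => u.
by have := pP ((p^-1)%g u); rewrite permKV sedge_sym.
Qed.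

Lemma transports_sub r s p (u v : hypercube d) : sedge r s -> transports r s p ->
  hypercube_edge u v -> hypercube_edge (p u) (p v).
Proof.
move=> rs /forallP pP; rewrite -{1}(coord_point r u) -{1}(coord_point r v).
rewrite coord_sedge ?rt_point // => uv.
rewrite -(coord_point s (p u)) -(coord_point s (p v)) coord_sedge ?rt_point //.
apply: (@flat_edge (point r u) _ (point r v)); rewrite ?rt_point //.
  exact: point_flat.
exact: point_flat.
Qed.

(** On a base edge exactly one permutation qualifies; this uniqueness forces [sigma s r] to be the
    inverse. *)
Definition sigma r s := odflt 1%g [pick p | transports r s p].

Lemma sigmaP r s : sedge r s -> transports r s (sigma r s).
Proof.
move=> rs; rewrite /sigma; case: pickP => //= none.
by have [p] := transports_ex rs; rewrite none.
Qed.

Lemma sigma_aut (r s : base) : sedge r s -> is_automorphism (sigma r s).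
Proof.
move=> rs u v; apply/idP/idP; last exact: transports_sub (sigmaP rs).
have sr : sedge s r by rewrite sedge_sym.
move=> /(transports_sub sr (transportsV (sigmaP rs))).
by rewrite !permK.
Qed.

Lemma sigma_inv (r s : base) : sedge r s -> sigma s r = ((sigma r s)^-1)%g.
Proof.
move=> rs; have sr : sedge s r by rewrite sedge_sym.
exact: transports_unique sr (sigmaP sr) (transportsV (sigmaP rs)).
Qed.

Lemma isomorphic_bundle : isomorphic G (bundle (Connection sigma_aut sigma_inv)).
Proof.
exists chart.
  exists (fun p => point p.1 p.2) => [x|[r u]]; first exact: point_chart.
  exact: chart_point.
move=> x y; rewrite /= /bundle_edge /=.
have [er|ner] := eqVneq (rt x) (rt y).
  have -> : (base_of x == base_of y) = true by apply/eqP/val_inj.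
  by rewrite /base_edge /= er sedge_irr coord_sedge.
(* Between different cubes an edge is flat: it projects to a base edge, and [flat_unique] shows that
   its end is the transported point. *)
have -> : (base_of x == base_of y) = false.
  by apply: contraNF ner => /eqP[->].
rewrite orbF; apply/andP/idP => [[rs /eqP e]|xy].
  have /forallP/(_ (coord x)) := sigmaP rs.
  by rewrite -e !point_chart.
have fxy := rt_neq_sedge ner xy.
have rs : sedge (base_of x) (base_of y) by have /andP[] := flat_rt fxy.
split=> //; apply/eqP; rewrite -[RHS](coord_point (base_of y)); congr coord.
apply: flat_unique fxy _ _; last by rewrite rt_point.
have /forallP/(_ (coord x)) := sigmaP rs.
rewrite point_chart; apply: rt_neq_sedge.
by rewrite rt_point.
Qed.

End Coordinates.

Lemma squares_hypercube_bundle x0 y0 : connected_graph G ->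
  sedge x0 y0 -> f x0 != f y0 -> hypercube_bundle G.
Proof.
move=> [_ conn] xy fxy; pose d := (#|up_set f x0| + rank x0)%N.
have valency x : (#|up_set f x| + rank x = d)%N.
  have /connectP[p] := conn x0 x; rewrite /d;
  elim: p x0 {d xy fxy} => [z _ -> //|c p IH z /= /andP[zc cp] e].
  by rewrite (IH c cp e) -(card_up_down_sedge zc).
exists d; exists base; exists (Connection (sigma_aut valency) (sigma_inv valency)).
split; last exact: isomorphic_bundle.
(* The non-flat edge at [x0] is counted by [d], whence [1 <= d]. *)
rewrite /d addn_gt0 !card_gt0; apply/orP.
case: (sedge_cases f xy) => [/andP[_ e]|xy'|yx]; first by rewrite e in fxy.
  by left; apply/set0Pn; exists y0; rewrite inE.
by right; apply/set0Pn; exists y0; rewrite inE.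
Qed.

End Components.
End Height.

(** * Curvature calculus with the adjacency matrix *)

Section Curvature.
Variables (R : realType) (G : sgraph).
Implicit Types (f g h : G -> R) (x y z : G).

Definition adj x y : R := (sedge x y)%:R.

Lemma adjC x y : adj x y = adj y x.
Proof. by rewrite /adj sedge_sym. Qed.

Lemma adj_ge0 x y : 0 <= adj x y.
Proof. exact: ler0n. Qed.

Lemma adj_irr x : adj x x = 0.
Proof. by rewrite /adj sedge_irr. Qed.

Lemma adj_sqr x y : adj x y * adj x y = adj x y.
Proof. by rewrite /adj -natrM mulnb andbb. Qed.

Lemma sum_sedge x (F : G -> R) :
  \sum_(y : G | sedge x y) F y = \sum_y adj x y * F y.
Proof.
rewrite big_mkcond; apply: eq_bigr => y _ /=.
by rewrite /adj; case: ifP; rewrite ?mul1r ?mul0r.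
Qed.

Lemma sum_delta z (F : G -> R) : \sum_y F y * (y == z)%:R = F z.
Proof.
rewrite (bigD1 z) //= eqxx mulr1 big1 ?addr0 // => y /negbTE ->.
by rewrite mulr0.
Qed.

Lemma deg_adj x : (deg x)%:R = \sum_y adj x y.
Proof.
rewrite /deg -sum1_card natr_sum big_mkcond; apply: eq_bigr => y _ /=.
by rewrite inE /adj; case: ifP.
Qed.

Lemma laplE h x : lapl h x = \sum_y adj x y * h y - (deg x)%:R * h x.
Proof.
rewrite /lapl sum_sedge deg_adj mulr_suml -sumrB.
by apply: eq_bigr => y _; rewrite mulrBr.
Qed.

Lemma GammaE f g x : 2 * Gamma f g x = \sum_y adj x y * ((f y - f x) * (g y - g x)).
Proof. by rewrite /Gamma sum_sedge mulrA divff ?mul1r // pnatr_eq0. Qed.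

Lemma GammaC f g x : Gamma f g x = Gamma g f x.
Proof. by congr (_ * _); apply: eq_bigr => y _; rewrite mulrC. Qed.

Lemma Gamma_lin f g h t x :
  Gamma f (fun y => g y + t * h y) x = Gamma f g x + t * Gamma f h x.
Proof.
rewrite /Gamma mulrCA -mulrDr; congr (_ * _); rewrite mulr_sumr -big_split /=.
by apply: eq_bigr => y _; ring.
Qed.

Lemma lapl_lin g h t x :
  lapl (fun y => g y + t * h y) x = lapl g x + t * lapl h x.
Proof.
rewrite /lapl mulr_sumr -big_split /=.
by apply: eq_bigr => y _; ring.
Qed.

Lemma Gamma2C f g x : Gamma2 f g x = Gamma2 g f x.
Proof.
rewrite /Gamma2; have -> : Gamma f g = Gamma g f by apply/funext => y; exact: GammaC.
by rewrite addrAC.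
Qed.

Lemma Gamma2_lin f g h t x :
  Gamma2 f (fun y => g y + t * h y) x = Gamma2 f g x + t * Gamma2 f h x.
Proof.
rewrite /Gamma2.
have -> : Gamma f (fun y => g y + t * h y) = fun y => Gamma f g y + t * Gamma f h y.
  by apply/funext => y; exact: Gamma_lin.
have -> : lapl (fun y => g y + t * h y) = fun y => lapl g y + t * lapl h y.
  by apply/funext => y; exact: lapl_lin.
rewrite lapl_lin Gamma_lin !(GammaC _ (lapl f)) Gamma_lin; ring.
Qed.

Lemma sum_lapl h : \sum_x lapl h x = 0.
Proof.
under eq_bigr do rewrite /lapl sum_sedge.
set s := \sum_x _; suff : s + s = 0 by lra.
rewrite {1}/s exchange_big -big_split big1 //= => x _.
by rewrite -big_split big1 //= => y _; rewrite adjC; ring.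
Qed.

Lemma polar_eq0 (a b : R) : (forall t, 0 <= t * b + t ^+ 2 * a) -> b = 0.
Proof.
move=> H; have a1 : 0 < `|a| + 1 by have := normr_ge0 a; lra.
(* The added 1 keeps the denominator positive and [a - (|a| + 1)] negative, so the value is negative
   unless [b = 0]. *)
have := H (- b / (`|a| + 1)).
have -> : - b / (`|a| + 1) * b + (- b / (`|a| + 1)) ^+ 2 * a =
          (b ^+ 2) * (a - (`|a| + 1)) / (`|a| + 1) ^+ 2.
  by field; rewrite gt_eqF.
rewrite pmulr_lge0 ?invr_gt0 ?exprn_gt0 // => H0.
have al := ler_norm a; have := sqr_ge0 b.
have b2 : b ^+ 2 = 0 by nra.
by move/eqP: b2; rewrite sqrf_eq0 => /eqP.
Qed.

(* Green's formula for the symmetric weight w. *)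
Lemma harmonic_edge (w : G -> G -> R) f : (forall x y, f x != f y -> w x y = w y x) ->
  (forall x y, f x != f y -> 0 <= w x y) ->
  (forall x, \sum_y w x y * (f y - f x) = 0) ->
  forall x y, f x != f y -> w x y = 0.
Proof.
move=> wC w0 H.
have E : \sum_x \sum_y w x y * (f y - f x) ^+ 2 = 0.
  transitivity (- (2 * \sum_x f x * \sum_y w x y * (f y - f x))); last first.
    by rewrite big1 ?mulr0 ?oppr0 // => x _; rewrite H mulr0.
  rewrite mulr_natl mulr2n; under [in RHS]eq_bigr do rewrite mulr_sumr.
  rewrite [X in _ = - (X + _)]exchange_big -big_split -sumrN; apply: eq_bigr => x _.
  rewrite /= -big_split -sumrN; apply: eq_bigr => y _ /=.
  have [->|/wC ->] := eqVneq (f x) (f y); ring.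
have t0 x y : 0 <= w x y * (f y - f x) ^+ 2.
  have [->|/w0 wxy] := eqVneq (f x) (f y); first by rewrite subrr expr0n mulr0.
  by rewrite mulr_ge0 ?sqr_ge0.
move=> x y fxy.
have Ex := psumr_eq0P (fun x _ => sumr_ge0 _ (fun y _ => t0 x y)) E (i := x) isT.
have := psumr_eq0P (fun y _ => t0 x y) Ex (i := y) isT.
move/eqP; rewrite mulf_eq0 sqrf_eq0 subr_eq0 [f y == _]eq_sym (negbTE fxy) orbF.
by move/eqP.
Qed.

(** * The double commutator of a sharp eigenfunction *)

Section Eigenfunction.
Variables (K : R) (f : G -> R).
Hypotheses (cdK : CD G K) (fK : forall x, lapl f x = - (K * f x)).

(* Equality holds in the curvature inequality for f, as it does on summing over
all vertices; hence f lies in the kernel of the nonnegative form Gamma2 - K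
Gamma at each vertex. *)
Lemma Gamma2_eigenfunction g x : Gamma2 f g x = K * Gamma f g x.
Proof.
have laplf : lapl f = fun y => 0 + (- K) * f y by apply/funext => y; rewrite fK; ring.
have Gf h y : Gamma h (lapl f) y = - (K * Gamma h f y).
  rewrite laplf (Gamma_lin h (fun=> 0)); have -> : Gamma h (fun=> 0) y = 0.
    by rewrite /Gamma big1 ?mulr0 // => z _; rewrite subrr mulr0.
  by rewrite add0r mulNr.
have E y : Gamma2 f f y = K * Gamma f f y.
  have E0 : \sum_y (Gamma2 f f y - K * Gamma f f y) = 0.
    transitivity (2^-1 * \sum_y lapl (Gamma f f) y); last by rewrite sum_lapl mulr0.
    rewrite mulr_sumr; apply: eq_bigr => z _; rewrite /Gamma2 !Gf; lra.
  apply/eqP; rewrite -subr_eq0; apply/eqP.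
  have ge0 z : 0 <= Gamma2 f f z - K * Gamma f f z by rewrite subr_ge0.
  exact: (psumr_eq0P (fun z _ => ge0 z) E0 (i := y) isT).
suff : 2 * (Gamma2 f g x - K * Gamma f g x) = 0 by lra.
apply: (@polar_eq0 (Gamma2 g g x - K * Gamma g g x)) => t.
pose u y := f y + t * g y; have := cdK u x.
have Gu h : Gamma h u x = Gamma h f x + t * Gamma h g x by exact: Gamma_lin.
have G2u h : Gamma2 h u x = Gamma2 h f x + t * Gamma2 h g x by exact: Gamma2_lin.
rewrite Gu G2u !(GammaC u) !(Gamma2C u) !Gu !G2u E (Gamma2C g f) (GammaC g f).
by rewrite -subr_ge0; congr (0 <= _); ring.
Qed.

(** The commutator of [lapl] with multiplication by [f], that is, [lapl (f g) - f lapl g]. *)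
Let T g x := \sum_y adj x y * ((f y - f x) * g y).

(** The kernel identity becomes [lapl (Gamma f g) - Gamma f (lapl g) = K * Gamma f g]. Substituting
    [2 * Gamma f g = T g + K * f g] cancels the terms [K * T g]. *)
Lemma commutator_eigenfunction g x :
  lapl (T g) x - T (lapl g) x = K ^+ 2 * (f x * g x).
Proof.
have TE h y : 2 * Gamma f h y = T h y + K * (f y * h y).
  rewrite GammaE /T mulrA -[K * f y]opprK -fK /lapl sum_sedge mulNr mulr_suml -sumrB.
  by apply: eq_bigr => z _; ring.
have H := Gamma2_eigenfunction g x.
have laplf : lapl f = fun y => 0 + (- K) * f y by apply/funext => y; rewrite fK; ring.
have Gf : Gamma g (lapl f) x = - (K * Gamma f g x).
  rewrite laplf (Gamma_lin g (fun=> 0)); have -> : Gamma g (fun=> 0) x = 0.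
    by rewrite /Gamma big1 ?mulr0 // => z _; rewrite subrr mulr0.
  by rewrite add0r mulNr GammaC.
have LG : 2 * lapl (Gamma f g) x =
    lapl (T g) x + K * (T g x + f x * lapl g x).
  rewrite /lapl !sum_sedge mulr_sumr /T mulr_sumr -big_split /= mulr_sumr -big_split /=.
  apply: eq_bigr => y _.
  have -> : 2 * (adj x y * (Gamma f g y - Gamma f g x)) =
    adj x y * (2 * Gamma f g y - 2 * Gamma f g x) by ring.
  rewrite !TE /T; ring.
have := TE (lapl g) x; have := TE g x; move: H; rewrite /Gamma2 Gf.
set a := Gamma f g x; set b := Gamma f (lapl g) x; set c := lapl (Gamma f g) x in LG *.
move=> H Ha Hb; have {}H : c - b = K * a by lra.
have : 2 * c - 2 * b = K * (2 * a) by rewrite -mulrBr H; ring.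
rewrite LG Ha Hb => e; apply/eqP; rewrite -subr_eq0; apply/eqP.
move/eqP: e; rewrite -subr_eq0 => /eqP <-; ring.
Qed.

(** The sum is the entry of [[A, [A, f]]]; the diagonal part of [lapl] accounts for the degree
    term. *)
Lemma commutator_entry x z :
  \sum_y adj x y * adj y z * (f x + f z - 2 * f y)
    - ((deg x)%:R - (deg z)%:R) * (adj x z * (f z - f x))
  = K ^+ 2 * (f x * (x == z)%:R).
Proof.
rewrite -(commutator_eigenfunction (fun y => (y == z)%:R)) {2}/T laplE.
have Td y : T (fun t => (t == z)%:R) y = adj y z * (f z - f y).
  by rewrite /T; under eq_bigr do rewrite mulrA; rewrite sum_delta.
have Ld y : lapl (fun t => (t == z)%:R) y = adj y z - (deg y)%:R * (y == z)%:R.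
  by rewrite laplE sum_delta.
have -> : \sum_y adj x y * ((f y - f x) * lapl (fun t => (t == z)%:R) y) =
   \sum_y adj x y * adj y z * (f y - f x) - (deg z)%:R * (adj x z * (f z - f x)).
  rewrite -(sum_delta z (fun y => (deg y)%:R * (adj x y * (f y - f x)))) -sumrB.
  by apply: eq_bigr => y _; rewrite Ld; ring.
rewrite Td; under [X in _ = X - _ - _]eq_bigr do rewrite Td.
have -> : \sum_y adj x y * adj y z * (f x + f z - 2 * f y) =
  \sum_y adj x y * (adj y z * (f z - f y)) - \sum_y adj x y * adj y z * (f y - f x).
  by rewrite -sumrB; apply: eq_bigr => y _; ring.
ring.
Qed.

(** On the diagonal the sum is [- 2 * lapl f x], so the entry reads [2 * K * f x = K ^+ 2 * f x]. *)
Lemma eigenvalue_eq2 x : 0 < K -> f x != 0 -> K = 2.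
Proof.
move=> K0 fx; have := commutator_entry x x; rewrite subrr mul0r subr0 eqxx mulr1.
have -> : \sum_y adj x y * adj y x * (f x + f x - 2 * f y) = 2 * K * f x.
  rewrite -mulrA -[K * _]opprK -fK /lapl sum_sedge mulrN mulr_sumr -sumrN.
  by apply: eq_bigr => y _; rewrite (adjC y) adj_sqr; ring.
move=> /(mulIf fx)/eqP; rewrite expr2 (inj_eq (mulIf (lt0r_neq0 K0))).
by move=> /eqP.
Qed.
End Eigenfunction.

(** * Walk counts and a curvature test on squares *)

Definition walks2 x z : R := \sum_y adj x y * adj y z.
Definition walks3 x y : R := \sum_z adj x z * walks2 z y.

Lemma walks2C x z : walks2 x z = walks2 z x.
Proof. by apply: eq_bigr => y _; rewrite mulrC (adjC y) (adjC x). Qed.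

Lemma walks3E x y : walks3 x y = \sum_z walks2 x z * adj z y.
Proof.
rewrite /walks3; under eq_bigr do rewrite mulr_sumr.
rewrite exchange_big; apply: eq_bigr => z _ /=.
by rewrite mulr_suml; apply: eq_bigr => t _; rewrite mulrA.
Qed.

Lemma walks3C x y : walks3 x y = walks3 y x.
Proof. by rewrite walks3E; apply: eq_bigr => z _; rewrite mulrC adjC walks2C. Qed.

Lemma walks2_ge0 x z : 0 <= walks2 x z.
Proof. by apply: sumr_ge0 => y _; rewrite mulr_ge0 ?adj_ge0. Qed.

Lemma walks2_ge1 x y z : sedge x y -> sedge y z -> 1 <= walks2 x z.
Proof.
move=> xy yz; rewrite /walks2 (bigD1 y) //= /adj xy yz mulr1 lerDl.
by apply: sumr_ge0 => u _; rewrite -natrM ler0n.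
Qed.

Lemma walks2_deg x : walks2 x x = (deg x)%:R.
Proof. by rewrite deg_adj; apply: eq_bigr => y _; rewrite (adjC y) adj_sqr. Qed.

Lemma walks2_eq0 x y z : walks2 x y = 0 -> adj x z * adj z y = 0.
Proof.
move=> n0; have ge0 u : 0 <= adj x u * adj u y by rewrite mulr_ge0 ?adj_ge0.
exact: (psumr_eq0P (fun u _ => ge0 u) n0 (i := z) isT).
Qed.

Lemma walks2_card x z : walks2 x z = #|[set y | sedge x y && sedge y z]|%:R.
Proof.
rewrite -sum1_card natr_sum big_mkcond; apply: eq_bigr => y _ /=.
by rewrite inE /adj; case: (sedge x y); case: (sedge y z); rewrite ?mul0r ?mulr0 ?mul1r.
Qed.

(* Apply CD at x to the function equal to 1 at y, to h at the neighbours z != x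
of y, and to 0 elsewhere. *)
Lemma CD_square_test x y (h : G -> R) : CD G (2 : R) -> sedge x y ->
  walks2 x y = 0 -> deg x = deg y ->
  0 <= \sum_z adj y z * (z != x)%:R * (walks2 x z * h z ^+ 2 - 4 * h z + 2).
Proof.
move=> cd xy n0 dxy; pose b z := adj y z * (z != x)%:R.
pose g z := (z == y)%:R + b z * h z.
have axy : adj x y = 1 by rewrite /adj xy.
have by0 : b y = 0 by rewrite /b adj_irr mul0r.
have gx : g x = 0.
  rewrite /g /b eqxx mulr0 mul0r addr0; case: eqP => // e.
  by move: xy; rewrite -e sedge_irr.
have gy : g y = 1 by rewrite /g by0 eqxx mul0r addr0.
have dE z : adj x z * (z == y)%:R = (z == y)%:R.
  by case: eqP => [->|_]; rewrite ?axy ?mulr1 ?mulr0.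
(* As [x] and [y] have no common neighbour, [g] restricted to the neighbours of [x] is the indicator
   of [y]. *)
have ab z : adj x z * b z = 0.
  by rewrite /b mulrA (adjC y) walks2_eq0 // mul0r.
have ag z : adj x z * g z = (z == y)%:R.
  by rewrite /g mulrDr dE mulrA ab mul0r addr0.
have bb z : b z * b z = b z.
  by rewrite /b mulrACA adj_sqr -natrM mulnb andbb.
have aby z : adj y z * b z = b z by rewrite /b mulrA adj_sqr.
have ady z : adj y z * (z == y)%:R = 0.
  by case: eqP => [->|_]; rewrite ?mulr0 // adj_irr mul0r.
have agy z : adj y z * g z = b z * h z.
  by rewrite /g mulrDr ady add0r mulrA aby.
have dd z : ((z == y)%:R * (z == y)%:R : R) = (z == y)%:R by rewrite -natrM mulnb andbb.
have db z : (z == y)%:R * b z = 0.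
  by case: eqP => [->|_]; rewrite ?by0 ?mulr0 ?mul0r.
have g2 z : g z ^+ 2 = (z == y)%:R + b z * h z ^+ 2.
  have -> : g z ^+ 2 = (z == y)%:R * (z == y)%:R + 2 * ((z == y)%:R * b z) * h z
     + b z * b z * h z ^+ 2 by rewrite /g; ring.
  by rewrite dd db bb mulr0 mul0r addr0.
have Gx k : 2 * Gamma g k x = k y - k x.
  rewrite GammaE -(sum_delta y (fun z => k z - k x)); apply: eq_bigr => z _.
  by rewrite gx subr0 mulrA ag mulrC.
have Lx : lapl g x = 1.
  rewrite laplE gx mulr0 subr0; under eq_bigr do rewrite ag.
  by rewrite -[RHS](sum_delta y (fun=> 1)); apply: eq_bigr => z _; rewrite mul1r.
have Ly : lapl g y = \sum_z b z * h z - (deg y)%:R.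
  by rewrite laplE gy mulr1; congr (_ - _); apply: eq_bigr => z _; rewrite agy.
have LG : 2 * lapl (Gamma g g) x = \sum_z walks2 x z * (b z * h z ^+ 2)
    - 2 * \sum_z b z * h z.
  rewrite laplE mulrBr mulrCA Gx gx gy subr0 mulr1 dxy.
  have -> : 2 * \sum_u adj x u * Gamma g g u =
      \sum_u \sum_z adj x u * adj u z * g z ^+ 2
      + \sum_u (\sum_z (adj u z - 2 * (adj u z * g z))) * (u == y)%:R.
    rewrite mulr_sumr -big_split; apply: eq_bigr => u _ /=.
    rewrite mulrCA GammaE mulr_sumr mulr_suml -big_split; apply: eq_bigr => z _ /=.
    have -> : adj x u * (adj u z * ((g z - g u) * (g z - g u))) =
      adj x u * adj u z * g z ^+ 2 + (adj u z - 2 * (adj u z * g z)) * (adj x u * g u)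
      + adj u z * (g u * (adj x u * g u) - adj x u * g u) by ring.
    rewrite ag [g u * _](_ : _ = (u == y)%:R) ?subrr ?mulr0 ?addr0 //.
    by case: eqP => [->|_]; rewrite ?gy ?mulr0 ?mulr1.
  rewrite sum_delta sumrB -deg_adj exchange_big -mulr_sumr.
  under [X in _ + (_ - 2 * X)]eq_bigr do rewrite agy.
  have -> : \sum_j \sum_i adj x i * adj i j * g j ^+ 2 =
      \sum_z walks2 x z * (b z * h z ^+ 2) + \sum_z walks2 x z * (z == y)%:R.
    rewrite -big_split; apply: eq_bigr => z _ /=.
    by rewrite -mulr_suml g2 -/(walks2 x z); ring.
  by rewrite sum_delta n0; ring.
have sb : \sum_z b z = (deg y)%:R - 1.
  rewrite deg_adj -[X in _ - X](_ : \sum_z adj y z * (z == x)%:R = 1).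
    rewrite -sumrB; apply: eq_bigr => z _; rewrite /b.
    by case: eqP => _; rewrite ?mulr1 ?mulr0 ?subr0 ?subrr.
  by rewrite sum_delta adjC.
have := cd g x; rewrite /Gamma2.
have := Gx (lapl g); have := Gx g; rewrite Lx Ly gx gy => G1 G2 C.
have : 0 <= \sum_z walks2 x z * (b z * h z ^+ 2) - 4 * \sum_z b z * h z + 2 * \sum_z b z.
  by rewrite sb; lra.
rewrite !mulr_sumr -sumrB -big_split /=; congr (0 <= _).
by apply: eq_bigr => z _; rewrite -/(b z); ring.
Qed.

(** * Squares from the commutation relation and curvature *)

Section Commutation.
Variable f : G -> R.
Hypothesis f2 : forall x, lapl f x = - (2 * f x).
Hypothesis comm : forall x z,
  \sum_y adj x y * adj y z * (f x + f z - 2 * f y) = 4 * (f x * (x == z)%:R).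

Lemma walks2_comm x z : walks2 x z * (f x + f z) =
  2 * (\sum_y adj x y * f y * adj y z) + 4 * (f x * (x == z)%:R).
Proof.
rewrite -comm mulr_suml mulr_sumr -big_split; apply: eq_bigr => y _ /=; ring.
Qed.

(** Contract [walks2_comm] with [adj x z]: the delta term dies, and exchanging the sums turns the
    right side into twice the sum of [adj x y * walks2 x y * f y]. *)
Lemma walks2_harmonic x : \sum_y adj x y * walks2 x y * (f y - f x) = 0.
Proof.
have H : \sum_z adj x z * (walks2 x z * (f x + f z)) =
    2 * \sum_y adj x y * walks2 x y * f y.
  under eq_bigr do rewrite walks2_comm mulrDr mulrCA mulr_sumr.
  rewrite big_split /= [X in _ + X]big1 ?addr0 => [|z _]; last first.
    by case: eqP => [->|_]; rewrite ?adj_irr ?mulr0 ?mul0r.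
  rewrite -mulr_sumr exchange_big; congr (_ * _); apply: eq_bigr => y _ /=.
  rewrite walks2C /walks2 mulr_sumr mulr_suml; apply: eq_bigr => z _.
  by rewrite (adjC z x); ring.
transitivity (2 * (\sum_y adj x y * walks2 x y * f y)
    - \sum_z adj x z * (walks2 x z * (f x + f z))); last by rewrite H subrr.
by rewrite mulr_sumr -sumrB; apply: eq_bigr => y _; ring.
Qed.

Lemma walks3_harmonic x :
  \sum_y adj x y * (walks3 x y - 3 * (deg x)%:R + 2) * (f y - f x) = 0.
Proof.
pose AMA2 v w := \sum_z adj v z * f z * walks2 z w.
pose A2MA v w := \sum_z walks2 v z * f z * adj z w.
(* The relation [f A^2 + A^2 f = 2 A f A + 4 f] multiplied by [A] on the right, then on the left.
   Twice the first plus the second eliminates [A2MA], which gives [both]. *)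
have right v w : f v * walks3 v w + A2MA v w = 2 * AMA2 v w + 4 * (f v * adj v w).
  have -> : f v * walks3 v w + A2MA v w = \sum_z walks2 v z * (f v + f z) * adj z w.
    by rewrite walks3E mulr_sumr -big_split; apply: eq_bigr => z _ /=; ring.
  under eq_bigr do rewrite walks2_comm mulrDl -mulrA mulr_suml.
  rewrite big_split /= -mulr_sumr exchange_big; congr (2 * _ + _).
    apply: eq_bigr => y _ /=; rewrite /walks2 mulr_sumr.
    by apply: eq_bigr => z _; ring.
  rewrite -(sum_delta v (fun z => 4 * (f v * adj z w))); apply: eq_bigr => z _.
  by rewrite (eq_sym v); ring.
have left v w : AMA2 v w + f w * walks3 v w = 2 * A2MA v w + 4 * (adj v w * f w).
  have -> : AMA2 v w + f w * walks3 v w = \sum_z adj v z * (walks2 z w * (f z + f w)).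
    by rewrite /walks3 mulr_sumr -big_split; apply: eq_bigr => z _ /=; ring.
  under eq_bigr do rewrite walks2_comm mulrDr mulrCA mulr_sumr.
  rewrite big_split /= -mulr_sumr exchange_big; congr (2 * _ + _).
    apply: eq_bigr => y _ /=; rewrite /walks2 !mulr_suml.
    by apply: eq_bigr => z _; ring.
  rewrite -(sum_delta w (fun z => 4 * (adj v z * f z))); apply: eq_bigr => z _.
  by ring.
have both w : walks3 x w * (f w + 2 * f x) =
    3 * AMA2 x w + 8 * (f x * adj x w) + 4 * (adj x w * f w).
  by have := right x w; have := left x w; lra.
(* Both sides are the diagonal entry of [A f A^3] at [x]. *)
have E1 : \sum_w adj x w * AMA2 x w = \sum_w adj x w * walks3 x w * f w.
  under eq_bigr do rewrite mulr_sumr.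
  rewrite exchange_big; apply: eq_bigr => z _ /=.
  rewrite walks3C /walks3 mulr_sumr mulr_suml.
  rewrite -[LHS]/(\sum_i adj x i * (adj x z * f z * walks2 z i)).
  rewrite -mulr_suml -mulr_sumr -/(walks3 z x) walks3E.
  rewrite mulr_sumr mulr_suml; apply: eq_bigr => w _.
  by rewrite (adjC w); ring.
have E2 : \sum_w adj x w * f w = (deg x)%:R * f x - 2 * f x.
  by have := f2 x; rewrite laplE; lra.
have E3 : \sum_w adj x w * walks3 x w * (f w + 2 * f x) =
   3 * (\sum_w adj x w * walks3 x w * f w) + 8 * (f x * (deg x)%:R)
   + 4 * \sum_w adj x w * f w.
  rewrite -E1 deg_adj !mulr_sumr -!big_split; apply: eq_bigr => w _ /=.
  rewrite -mulrA both.
  transitivity (3 * (adj x w * AMA2 x w) + adj x w * adj x w * (8 * f x + 4 * f w)).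
    by ring.
  by rewrite adj_sqr; ring.
rewrite E2 in E3.
have E4 : \sum_w adj x w * walks3 x w * (f w + 2 * f x) =
  \sum_w adj x w * walks3 x w * f w + 2 * (f x * \sum_w adj x w * walks3 x w).
  by rewrite !mulr_sumr -big_split; apply: eq_bigr => w _ /=; ring.
transitivity (\sum_w adj x w * walks3 x w * f w - f x * (\sum_w adj x w * walks3 x w)
   + (2 - 3 * (deg x)%:R) * lapl f x).
  rewrite /lapl sum_sedge !mulr_sumr -sumrB -big_split.
  by apply: eq_bigr => w _ /=; ring.
rewrite f2; lra.
Qed.

Hypothesis cd : CD G (2 : R).
Hypothesis deg_edge : forall x y, sedge x y -> f x != f y -> deg x = deg y.

Lemma walks2_edge x y : sedge x y -> f x != f y -> walks2 x y = 0.
Proof.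
move=> xy fxy.
suff : adj x y * walks2 x y = 0 by rewrite /adj xy mul1r.
apply: (harmonic_edge (w := fun x y => adj x y * walks2 x y)) fxy.
- by move=> u v _; rewrite adjC walks2C.
- by move=> u v _; rewrite mulr_ge0 ?adj_ge0 ?walks2_ge0.
exact: walks2_harmonic.
Qed.

(** In [walks3 x y] the neighbour [z = x] of [y] contributes [deg x]; the other [deg x - 1]
    neighbours absorb the remaining [- 2 * deg x + 2]. *)
Lemma walks3_edge x y : sedge x y -> f x != f y ->
  walks3 x y - 3 * (deg x)%:R + 2 = \sum_z adj y z * (z != x)%:R * (walks2 x z - 2).
Proof.
move=> xy fxy; rewrite walks3E (bigD1 x) //= walks2_deg /adj xy mulr1.
rewrite -!/(adj _ _).
have -> : \sum_z adj y z * (z != x)%:R * (walks2 x z - 2) =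
    \sum_(z | z != x) (adj z y * walks2 x z - 2 * adj y z).
  rewrite [RHS]big_mkcond; apply: eq_bigr => z _ /=.
  by rewrite (adjC z); case: ifP => _; rewrite ?mulr1 ?mulr0 ?mul0r //; ring.
have : (deg y)%:R = 1 + \sum_(z | z != x) adj y z.
  by rewrite deg_adj (bigD1 x) //= {1}/adj sedge_sym xy.
rewrite sumrB -mulr_sumr (deg_edge xy fxy) => ->.
under eq_bigr do rewrite mulrC -/(adj _ _).
ring.
Qed.

Lemma square_test_inv x y : sedge x y -> f x != f y ->
  0 <= \sum_z adj y z * (z != x)%:R * (2 - 4 / walks2 x z).
Proof.
move=> xy fxy.
(* [h = 2 / n] minimises [n h^2 - 4 h + 2], with minimum [2 - 4 / n]. *)
have := CD_square_test (fun z => 2 / walks2 x z) cd xy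
  (walks2_edge xy fxy) (deg_edge xy fxy).
congr (0 <= _); apply: eq_bigr => z _.
rewrite /adj; case yz: (sedge y z); last by rewrite !mul0r.
have n1 := walks2_ge1 xy yz; field; lra.
Qed.

(** Split [n - 2 = (2 - 4 / n) + (n - 2)^2 / n]. The first part sums to a nonnegative number by
    curvature, so the weight of [walks3_harmonic] is nonnegative, hence zero by [harmonic_edge], and
    every square vanishes. *)
Lemma walks2_eq2 x y z : sedge x y -> f x != f y -> sedge y z -> z != x ->
  walks2 x z = 2.
Proof.
move=> xy fxy yz zx.
pose e u v t := adj v t * (t != u)%:R * ((walks2 u t - 2) ^+ 2 / walks2 u t).
have e0 u v t : 0 <= e u v t.
  apply: mulr_ge0; first by rewrite mulr_ge0 ?adj_ge0 ?ler0n.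
  by rewrite divr_ge0 ?sqr_ge0 ?walks2_ge0.
have E u v : sedge u v -> f u != f v -> walks3 u v - 3 * (deg u)%:R + 2 =
    \sum_t adj v t * (t != u)%:R * (2 - 4 / walks2 u t) + \sum_t e u v t.
  move=> uv fuv; rewrite walks3_edge // -big_split; apply: eq_bigr => t _ /=.
  rewrite /e /adj; case vt: (sedge v t); last by rewrite !mul0r addr0.
  have n1 := walks2_ge1 uv vt; field; lra.
have W : walks3 x y - 3 * (deg x)%:R + 2 = 0.
  suff : adj x y * (walks3 x y - 3 * (deg x)%:R + 2) = 0 by rewrite /adj xy mul1r.
  apply: (harmonic_edge (w := fun x y =>
    adj x y * (walks3 x y - 3 * (deg x)%:R + 2))) fxy.
  - move=> u v fuv; rewrite adjC walks3C /adj.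
    by case vu: (sedge v u); rewrite ?mul0r // (deg_edge vu) // eq_sym.
  - move=> u v fuv; rewrite /adj; case uv: (sedge u v); last by rewrite mul0r.
    by rewrite mul1r E // addr_ge0 ?square_test_inv ?sumr_ge0.
  exact: walks3_harmonic.
have S0 : \sum_t e x y t = 0.
  apply/eqP; rewrite eq_le sumr_ge0 // andbT.
  by have := square_test_inv xy fxy; have := E x y xy fxy; lra.
have := psumr_eq0P (fun t _ => e0 x y t) S0 (i := z) isT.
have n1 := walks2_ge1 xy yz.
rewrite /e /adj yz zx !mul1r => /eqP; rewrite mulf_eq0 invr_eq0 sqrf_eq0 subr_eq0.
by case/orP => /eqP // n0; move: n1; rewrite n0; lra.
Qed.

(** [x] and [z] have exactly two common neighbours, and the off-diagonal entry [comm x z], a sum of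
    two terms, is the relation on values. *)
Lemma commutation_squares : squares f.
Proof.
move=> x y z xy fxy yz zx; have := walks2_eq2 xy fxy yz zx.
rewrite walks2_card => /eqP; rewrite (eqr_nat _ _ 2) => /eqP c2.
set C := [set _ | _] in c2; have yC : y \in C by rewrite inE xy.
have : #|C :\ y| == 1%N by rewrite -eqSS -c2 (cardsD1 y C) yC.
move=> /cards1P[y' ey'].
have : y' \in C :\ y by rewrite ey' set11.
rewrite !inE => /and3P[y'y xy' y'z]; exists y' => //; split=> // [|w xw wz].
  have := comm x z; rewrite eq_sym (negbTE zx) !mulr0.
  have -> : \sum_u adj x u * adj u z * (f x + f z - 2 * f u) =
      \sum_(u in C) (f x + f z - 2 * f u).
    rewrite [RHS]big_mkcond; apply: eq_bigr => u _ /=; rewrite inE /adj.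
    by case: (sedge x u); case: (sedge u z); rewrite ?mul0r ?mulr0 ?mul0r ?mul1r.
  rewrite (big_setD1 y) //= ey' big_set1; lra.
have [->|wy] := eqVneq w y; [by left|right].
by apply/set1P; rewrite -ey' !inE wy xw wz.
Qed.
End Commutation.
End Curvature.

(** * From the spectrum to the bundle *)

Lemma eigenfunction_ex (R : realType) (G : sgraph) (l : R) : is_lambda1 G l ->
  exists2 f : G -> R, (forall x, lapl f x = - (l * f x)) & exists x, f x != 0.
Proof.
move=> [s [[_ es] size_s el]].
have : eigenvalue (neg_lapl_mx R G) l.
  by rewrite eigenvalue_root_char es root_prod_XsubC -el mem_nth.
(* [v] is a row vector, hence a left eigenvector; symmetry of the adjacency turns it into an
   eigenfunction. *)
move=> /eigenvalueP[v ev v0]; exists (fun x => v 0 (enum_rank x)).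
  move=> x; have /rowP/(_ (enum_rank x)) := ev; rewrite !mxE => <-.
  rewrite -sumrN laplE.
  transitivity (\sum_y v 0 (enum_rank y) * (adj R x y - (deg x)%:R * (y == x)%:R)).
    under [RHS]eq_bigr do rewrite mulrBr.
    rewrite sumrB; congr (_ - _); first by apply: eq_bigr => y _; rewrite mulrC.
    rewrite -(sum_delta x (fun y => (deg x)%:R * v 0 (enum_rank y))).
    by apply: eq_bigr => y _; ring.
  rewrite (reindex (@enum_val _ G)) /=; last first.
    by exists enum_rank => i _; [exact: enum_valK|exact: enum_rankK].
  apply: eq_bigr => i _; rewrite !mxE enum_valK enum_rankK mulrN opprK; congr (_ * _).
  rewrite laplE sum_delta adjC; congr (_ - _).
  by case: eqP => [->|_]; rewrite ?mulr0.
have /rV0Pn[i vi] := v0; exists (enum_val i); by rewrite enum_valK.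
Qed.

Theorem theorem1p8 (R : realType) (G : sgraph)
  (Gconn : connected_graph G)
  (Gsharp : Lichnerowicz_sharp R G)
  (deg_const : forall x y : G,
     connect (@sedge (Gvis R G)) x y -> deg x = deg y) :
  hypercube_bundle G.
Proof.
case: Gsharp => K [K0 cd lK]; have [f fK [x fx]] := eigenfunction_ex lK.
have K2 := eigenvalue_eq2 cd fK K0 fx; rewrite {}K2 in cd fK.
(* Since [K = 2], [f] itself witnesses the visibility of such an edge. *)
have deg_edge u v : sedge u v -> f u != f v -> deg u = deg v.
  move=> uv fuv; apply: deg_const; apply: connect1; apply/andP; split=> //.
  by apply/asboolP; exists f; [move=> z; rewrite fK addNr|apply/eqP].
(* The degree term of [commutator_entry] vanishes on every pair: no edge, equal values of [f], or
   equal degrees. *)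
have comm u v : \sum_y adj R u y * adj R y v * (f u + f v - 2 * f y) =
    4 * (f u * (u == v)%:R).
  have <- : 2 ^+ 2 = 4 :> R by rewrite expr2 -natrM.
  rewrite -(commutator_entry cd fK u v).
  rewrite -[LHS]subr0; congr (_ - _); rewrite /adj;
  case uv: (sedge u v); last by rewrite mul0r mulr0.
  have [->|fuv] := eqVneq (f u) (f v); first by rewrite subrr !mulr0.
  by rewrite (deg_edge u v) // subrr mul0r.
have sq := commutation_squares fK comm cd deg_edge.
(* Otherwise [lapl f x = 0], against [lapl f x = - (2 * f x)] with [f x != 0]. *)
have [y xy fxy] : exists2 y, sedge x y & f x != f y.
  apply: contrapT => none; case/eqP: fx; have := fK x.
  rewrite /lapl big1 => [|y xy]; first by lra.
  apply/eqP; rewrite subr_eq0 eq_sym; apply: contraT => fxy.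
  by case: none; exists y.
exact: (squares_hypercube_bundle sq Gconn xy fxy).
Qed.
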